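(* Fix an integer $d\ge 2$. For each positive integer $n$, let $\mathcal{R}_n$ denote the base position in $[n]^d$ corresponding to a uniformly random Latin hypercube of order $n$ and dimension $d-1$. Then the probability that $\mathcal{R}_n$ is a solution tends to $0$ as $n\to\infty$.
   Context: $[n]^d$ denotes the graph whose vertices (also called cubes) are the $d$-tuples $(x_1,\dots,x_d)$ with $x_i\in\{1,\dots,n\}$; two vertices are neighbours if they differ in exactly one coordinate, and in that coordinate by exactly $1$. A position is any subset of the vertices of $[n]^d$. A dismantling move removes from the current position a vertex having exactly $d$ neighbours in the current position. A base position is a set of $n^{d-1}$ pairwise non-neighbouring vertices of $[n]^d$. A solution is a base position that can be obtained from the full position $[n]^d$ by a finite sequence of dismantling moves. A Latin hypercube of dimension $k$ and order $n$ is a $k$-dimensional $n\times\cdots\times n$ array $L$ on the $n$ symbols $1,\dots,n$ in which each symbol occurs exactly once in each line (a line being obtained by fixing all but one of the $k$ coordinates). The base position in $[n]^d$ corresponding to a Latin hypercube $L$ of dimension $d-1$ and order $n$ is $\{(x_1,\dots,x_{d-1},z): z=L(x_1,\dots,x_{d-1})\}$. ''Random'' refers to the uniform distribution on the finite set of all such Latin hypercubes. *)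

(* Defs.v *)
From mathcomp Require Import all_boot all_algebra.

Set Implicit Arguments.
Unset Strict Implicit.
Unset Printing Implicit Defensive.

Import GRing.Theory.

(* Coordinates and symbols range over 'I_n = {0, ..., n-1} instead of
   {1, ..., n}. *)

Definition cube (d n : nat) : finType := (d.-tuple 'I_n)%type.

Definition position (d n : nat) : finType := {set cube d n}.

(* Agreement of x and y in every coordinate other than i; for fixed x and i,
   the y satisfying this form the line through x in direction i. *)
Definition same_off (d n : nat) (i : 'I_d) (x y : cube d n) : bool :=
  [forall j : 'I_d, (j != i) ==> (tnth x j == tnth y j)].

Definition neighbours (d n : nat) (x y : cube d n) : bool :=
  [exists i : 'I_d,
     (((tnth x i).+1 == tnth y i :> nat) || ((tnth y i).+1 == tnth x i :> nat))
     && same_off i x y].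

Definition dismantling_move (d n : nat) : rel (position d n) :=
  fun P Q => [exists v : cube d n,
    [&& v \in P, #|[set w in P | neighbours v w]| == d & Q == P :\ v]].

Definition base_position (d n : nat) (P : position d n) : bool :=
  (#|P| == n ^ d.-1) && [forall x in P, forall y in P, ~~ neighbours x y].

Definition solution (d n : nat) (P : position d n) : bool :=
  base_position P && connect (@dismantling_move d n) [set: cube d n] P.

Definition array (k n : nat) : finType := {ffun cube k n -> 'I_n}.

Definition latin (k n : nat) (L : array k n) : bool :=
  [forall i : 'I_k, forall x : cube k n, forall s : 'I_n,
     #|[set y : cube k n | same_off i x y & L y == s]| == 1].

(* The cubes (x_1, ..., x_(d-1), L(x_1, ..., x_(d-1))), for d >= 1; equality is
   tested on the underlying sequences to avoid a cast between d and d.-1.+1. *)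
Definition corresponding_position (d n : nat) (L : array d.-1 n) :
    position d n :=
  [set x : cube d n |
    [exists y : cube d.-1 n, tval x == rcons (tval y) (L y)]].

(* Probability of E when drawing uniformly from a (nonempty) finite set A. *)
Definition uniform_prob (R : numFieldType) (T : finType) (A E : {set T}) : R :=
  (#|A :&: E|%:R / #|A|%:R)%R.

Definition prob_solution (R : numFieldType) (d n : nat) : R :=
  uniform_prob R [set L : array d.-1 n | latin L]
    [set L : array d.-1 n | solution (corresponding_position L)].

(* Main.v *)
(** Every line meets the final base position, so a removed cube, having exactly
    [d] neighbours, has exactly one in each direction; hence every position
    reached meets every line in an interval. In a plane spanned by the last
    direction and another one, the base position is the graph of a permutation.
    If this permutation contains the pattern 2413 at positions [a < b < c < e],
    the rectangle spanned by the columns [b], [c] and the two middle values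
    survives for ever: each of its cubes lies strictly between two cubes, taken
    from the rectangle and the pattern, on a common line. So no solution contains
    2413. On the other hand relabelling symbols preserves Latin hypercubes, and
    among the 24 relabellings of a block of 4 consecutive symbols at least one
    makes these symbols form 2413 along a fixed line; treating disjoint blocks
    one after the other bounds the probability of a solution by
    [(23/24)^(n/4)]. *)

Require Import Defs.
From mathcomp Require Import all_boot all_fingroup all_algebra.
From mathcomp Require Import zify.

Set Implicit Arguments.
Unset Strict Implicit.
Unset Printing Implicit Defensive.

(** * Convexity along lines under dismantling moves *)

Section Lines.
Variables d n : nat.
Implicit Types (i j : 'I_d) (x y v w : cube d n) (P Q B : position d n).

Definition upd x i (t : 'I_n) : cube d n :=
  [tuple if j == i then t else tnth x j | j < d].

Lemma tnth_upd x i t j : tnth (upd x i t) j = if j == i then t else tnth x j.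
Proof. by rewrite tnth_mktuple. Qed.

Lemma tnth_upd_same x i t : tnth (upd x i t) i = t.
Proof. by rewrite tnth_upd eqxx. Qed.

Definition coord x i : nat := tnth x i.

Lemma coord_lt x i : coord x i < n.
Proof. exact: ltn_ord. Qed.

Lemma coord_upd x i t : coord (upd x i t) i = t.
Proof. by rewrite /coord tnth_upd_same. Qed.

Lemma same_offP i x y :
  reflect (forall j, j != i -> tnth x j = tnth y j) (same_off i x y).
Proof.
apply: (iffP forallP) => h j; first by move=> ji; move: (h j); rewrite ji => /eqP.
by apply/implyP => ji; apply/eqP/h.
Qed.

Lemma same_off_coord i j x y :
  same_off i x y -> j != i -> coord x j = coord y j.
Proof. by move=> /same_offP h /h; rewrite /coord => ->. Qed.

Lemma same_off_sym i x y : same_off i x y = same_off i y x.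
Proof. by apply/same_offP/same_offP => h j /h. Qed.

Lemma same_off_trans i : transitive (@same_off d n i).
Proof.
move=> y x z /same_offP h1 /same_offP h2; apply/same_offP=> j ji.
by rewrite h1 ?h2.
Qed.

Lemma same_off_upd i x t : same_off i x (upd x i t).
Proof. by apply/same_offP => j ji; rewrite tnth_upd (negbTE ji). Qed.

Lemma same_off_eq i x y : same_off i x y -> coord x i = coord y i -> x = y.
Proof.
move=> /same_offP h /val_inj e; apply: eq_from_tnth => j.
by case: (eqVneq j i) => [->|/h].
Qed.

Definition line_convex P := forall i x y w,
  x \in P -> w \in P -> same_off i x y -> same_off i x w ->
  coord x i <= coord y i <= coord w i -> y \in P.

Definition meets_lines P := forall i x, exists2 y, y \in P & same_off i x y.

(** The disjunct of [neighbours] for direction [i], so that neighbours can be counted direction by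
    direction. *)
Definition step_along i : rel (cube d n) := fun x y =>
  ((((coord x i).+1 == coord y i) || ((coord y i).+1 == coord x i))
   && same_off i x y).

(** The cube next to [v] on the side of [x] lies between them, so convexity puts it in [P]. The
    strict inequality serves to tell neighbours on opposite sides of [v] apart. *)
Lemma step_below P i x v : line_convex P -> x \in P -> v \in P ->
  same_off i v x -> coord x i < coord v i ->
  exists2 w, w \in P & step_along i v w && (coord w i < coord v i).
Proof.
move=> cP xP vP vx lt_xv.
have lt_t : (coord v i).-1 < n by have := coord_lt v i; lia.
exists (upd v i (Ordinal lt_t)).
  have xv : same_off i x v by rewrite same_off_sym.
  apply: (cP i x _ v) => //; first exact: same_off_trans (same_off_upd _ _ _).
  by rewrite coord_upd -ltnS prednK ?lt_xv ?leq_pred ?(leq_ltn_trans _ lt_xv).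
have v_gt0 := leq_ltn_trans (leq0n _) lt_xv.
by rewrite /step_along coord_upd /= same_off_upd prednK // eqxx orbT leqnn.
Qed.

Lemma step_above P i x v : line_convex P -> x \in P -> v \in P ->
  same_off i v x -> coord v i < coord x i ->
  exists2 w, w \in P & step_along i v w && (coord v i < coord w i).
Proof.
move=> cP xP vP vx lt_vx.
have lt_t : (coord v i).+1 < n by have := coord_lt x i; lia.
exists (upd v i (Ordinal lt_t)).
  by apply: (cP i v _ x); rewrite ?coord_upd ?same_off_upd //=; lia.
by rewrite /step_along coord_upd /= same_off_upd eqxx ltnSn.
Qed.

(* The moved cube has a neighbour in each of the [d] directions, because every
   line still meets [Q], and [d] neighbours in all: exactly one per direction. *)
Lemma moved_not_between P Q i x v w : line_convex P -> meets_lines Q ->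
  v \in P -> #|[set u in P | neighbours v u]| = d -> Q = P :\ v ->
  x \in P -> w \in P -> same_off i v x -> same_off i v w ->
  coord x i < coord v i < coord w i -> False.
Proof.
move=> cP mQ vP cardN defQ xP wP vx vw /andP[lt_xv lt_vw].
have [a aP /andP[va lt_av]] := step_below cP xP vP vx lt_xv.
have [b bP /andP[vb lt_vb]] := step_above cP wP vP vw lt_vw.
(* With [a] set aside, each direction still offers a neighbour of [v]; in direction [i] it is [b].
   Counting [a] as well gives [d + 1] neighbours, one too many. *)
have ex_step j : exists u, [&& u \in P, u != a & step_along j v u].
  case: (eqVneq j i) => [->|ji].
    by exists b; rewrite bP vb andbT; apply/eqP => e; rewrite e in lt_vb; lia.
  have [y] := mQ j v; rewrite defQ !inE => /andP[y_v yP] vy.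
  have [u uP vu] : exists2 u, u \in P & step_along j v u.
    have ne_yv : (coord y j != coord v j :> nat).
      by apply: contra y_v => /eqP/esym /(same_off_eq vy) ->.
    case: (ltngtP (coord y j) (coord v j)) => [lt_yv|lt_vy|e].
    - by have [u ? /andP[? _]] := step_below cP yP vP vy lt_yv; exists u.
    - by have [u ? /andP[? _]] := step_above cP yP vP vy lt_vy; exists u.
    - by rewrite e eqxx in ne_yv.
  exists u; rewrite uP vu andbT; apply/eqP => e; rewrite e in vu.
  have e' : coord v i = coord a i.
    by case/andP: vu => _ /same_off_coord-> //; rewrite eq_sym.
  by rewrite e' ltnn in lt_av.
have [f fP] := fin_all_exists ex_step.
have f_inj : injective f.
  move=> j l fjl; apply/eqP/negPn/negP => jl.
  have /and3P[_ _ /andP[h _]] := fP j; have /and3P[_ _ /andP[_ vl]] := fP l.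
  by move: h; rewrite fjl (same_off_coord vl jl); lia.
have: f @: 'I_d \subset [set u in P | neighbours v u] :\ a.
  apply/subsetP => _ /imsetP[j _ ->]; have /and3P[fjP fja vfj] := fP j.
  by rewrite !inE fja fjP; apply/existsP; exists j.
move=> /subset_leq_card; rewrite card_imset // card_ord.
have: a \in [set u in P | neighbours v u].
  by rewrite inE aP; apply/existsP; exists i.
by move=> aN; move: cardN; rewrite (cardsD1 a) aN; lia.
Qed.

(** Removing [v] could only spoil a line on which [v] lies strictly between two remaining cubes,
    which [moved_not_between] excludes. *)
Lemma moved_line_convex P Q v : line_convex P -> meets_lines Q ->
  v \in P -> #|[set u in P | neighbours v u]| = d -> Q = P :\ v ->
  line_convex Q.
Proof.
move=> cP mQ vP cardN defQ i x y w.
rewrite {1 2}defQ !inE => /andP[xv xP] /andP[wv wP] xy xw xyw.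
have yP := cP i x y w xP wP xy xw xyw.
rewrite defQ !inE yP andbT; apply/eqP => yv; rewrite yv in xy xyw.
have vx : same_off i v x by rewrite same_off_sym.
have vw : same_off i v w by apply: same_off_trans xw.
have nx : coord x i != coord v i :> nat.
  by apply: contra xv => /eqP/(same_off_eq xy) ->.
have nw : coord w i != coord v i :> nat.
  by apply: contra wv => /eqP/esym/(same_off_eq vw) ->.
by apply: (moved_not_between cP mQ vP cardN defQ xP wP vx vw); lia.
Qed.

Lemma meets_linesW P Q : P \subset Q -> meets_lines P -> meets_lines Q.
Proof. by move=> /subsetP PQ mP i x; have [y /PQ] := mP i x; exists y. Qed.

Lemma connect_move_sub P Q : connect (@dismantling_move d n) P Q -> Q \subset P.
Proof.
case/connectP => p; elim: p P => [|R p IH] P /=; first by move=> _ ->.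
case/andP=> /existsP[v /and3P[_ _ /eqP ->]] /IH h /h.
by move=> /subset_trans; apply; rewrite subsetDl.
Qed.

Definition between (T : {set cube d n}) v := exists i, exists x, exists w,
  [/\ x \in T, w \in T, same_off i v x, same_off i v w &
      coord x i < coord v i < coord w i].

(* No cube of [S] can be the first one of [S] to be removed. *)
Lemma unbreakable_sub B (S : {set cube d n}) : meets_lines B ->
  {in S, forall v, between (B :|: S) v} ->
  connect (@dismantling_move d n) [set: cube d n] B -> S \subset B.
Proof.
move=> mB Sblock cTB.
(* Induction along the path needs an arbitrary convex starting position containing [S]. *)
suff main P : line_convex P -> S \subset P ->
    connect (@dismantling_move d n) P B -> S \subset B.
  by apply: main cTB; rewrite ?subsetT // => i x y w; rewrite !inE.
move=> cP SP /connectP[p]; elim: p P cP SP => [|Q p IH] P cP SP /=.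
  by move=> _ ->.
case/andP=> /existsP[v /and3P[vP /eqP cardN /eqP defQ]] pQ lastB.
(* Moves only delete cubes, so [Q] contains the final [B] and inherits from it that every line is
   met. *)
have BQ : B \subset Q by apply: connect_move_sub; apply/connectP; exists p.
have mQ := meets_linesW BQ mB.
have BSP : B :|: S \subset P.
  by rewrite subUset SP (subset_trans BQ) // defQ subsetDl.
apply: (IH Q) => //; first exact: moved_line_convex defQ.
rewrite defQ subsetD1 SP; apply/negP => vS.
have [i [x [w [xP wP vx vw lt_xvw]]]] := Sblock v vS.
exact: (moved_not_between cP mQ vP cardN defQ (subsetP BSP _ xP)
          (subsetP BSP _ wP) vx vw lt_xvw).
Qed.

End Lines.

(** * Graphs of Latin hypercubes and the pattern 2413 *)

Section Graph.
Variables k n : nat.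
Implicit Types (y : cube k n) (L : array k n).

(** Direction [ord_max] carries the symbol, and the directions [lift ord_max j] are those of the
    array. *)
Definition extend y (z : 'I_n) : cube k.+1 n := rcons_tuple y z.

Lemma tnth_extend_max y z : tnth (extend y z) ord_max = z.
Proof. by rewrite (tnth_nth z) /= nth_rcons size_tuple ltnn eqxx. Qed.

Lemma tnth_extend_lift y z j : tnth (extend y z) (lift ord_max j) = tnth y j.
Proof.
have jk : j < k := ltn_ord j.
by rewrite !(tnth_nth z) /= nth_rcons size_tuple /bump (leqNgt k) jk add0n jk.
Qed.

Lemma same_off_extend_max y z z' :
  same_off ord_max (extend y z) (extend y z').
Proof.
apply/same_offP => j; case: (unliftP ord_max j) => [l|] ->; rewrite ?eqxx //.
by rewrite !tnth_extend_lift.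
Qed.

Lemma same_off_extend_lift i y y' z : same_off i y y' ->
  same_off (lift ord_max i) (extend y z) (extend y' z).
Proof.
move=> /same_offP h; apply/same_offP => j.
case: (unliftP ord_max j) => [l|] ->; rewrite ?tnth_extend_max // !tnth_extend_lift.
by rewrite (inj_eq lift_inj) => /h.
Qed.

Lemma extend_surj (x : cube k.+1 n) : exists y z, x = extend y z.
Proof.
exists [tuple tnth x (lift ord_max j) | j < k], (tnth x ord_max).
apply: eq_from_tnth => j; case: (unliftP ord_max j) => [l|] ->.
  by rewrite tnth_extend_lift tnth_mktuple.
by rewrite tnth_extend_max.
Qed.

Lemma mem_corresponding L y z :
  (extend y z \in @corresponding_position k.+1 n L) = (L y == z).
Proof.
rewrite inE; apply/existsP/eqP => [[y' /eqP]|<-]; last by exists y; apply/eqP.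
by move=> /rcons_inj[/val_inj -> ->].
Qed.

(** In an array direction the Latin property for the symbol [z] provides the cube; in the last
    direction the value of [L] does. *)
Lemma latin_meets_lines L :
  latin L -> meets_lines (@corresponding_position k.+1 n L).
Proof.
move=> latL i x; have [y [z ->]] := extend_surj x.
case: (unliftP ord_max i) => [j|] ->.
  have /forallP/(_ j)/forallP/(_ y)/forallP/(_ z)/cards1P[y' /setP/(_ y')] := latL.
  rewrite !inE eqxx => /andP[yy' Ly'].
  by exists (extend y' z); rewrite ?mem_corresponding ?same_off_extend_lift.
by exists (extend y (L y)); rewrite ?mem_corresponding ?same_off_extend_max.
Qed.

(** Positions are arbitrary, but the values are the consecutive symbols from [s] to [s.+3], so
    disjoint blocks of symbols can be treated separately. *)
Definition pattern2413 (p : 'I_n -> 'I_n) (s : nat) : bool :=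
  [exists a : 'I_n, exists b : 'I_n, exists c : 'I_n, exists e : 'I_n,
    [&& [&& a < b, b < c & c < e], p a == s.+1 :> nat, p b == s.+3 :> nat,
        p c == s :> nat & p e == s.+2 :> nat]].

Definition line_map L (y0 : cube k n) (i : 'I_k) (t : 'I_n) : 'I_n :=
  L (upd y0 i t).

Lemma solution_avoids L y0 i s : latin L ->
  solution (@corresponding_position k.+1 n L) ->
  ~~ pattern2413 (line_map L y0 i) s.
Proof.
move=> latL /andP[_ solL]; apply/negP.
case/existsP=> a /existsP[b /existsP[c /existsP[e]]].
rewrite /line_map => /and5P[/and3P[ab bc ce] /eqP pa /eqP pb /eqP pc /eqP pe].
set B := @corresponding_position k.+1 n L in solL *.
have mB : meets_lines B := latin_meets_lines latL.
(* Column [t], height [z] in the plane through [y0] spanned by direction [i] and the last one. *)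
pose g (t z : 'I_n) := extend (upd y0 i t) z.
have gB t z : L (upd y0 i t) = z -> g t z \in B.
  by move=> e1; rewrite mem_corresponding e1.
have g_same_row t t' z : same_off (lift ord_max i) (g t z) (g t' z).
  apply: same_off_extend_lift; apply: same_off_trans (same_off_upd _ _ _).
  by rewrite same_off_sym same_off_upd.
have g_same_col t z z' : same_off ord_max (g t z) (g t z').
  exact: same_off_extend_max.
have g_row t z : coord (g t z) (lift ord_max i) = t.
  by rewrite /coord tnth_extend_lift tnth_upd_same.
have g_col t z : coord (g t z) ord_max = z by rewrite /coord tnth_extend_max.
(* The full rectangle: all columns from [b] to [c], at the heights [s.+1] and [s.+2]. *)
pose S := [set g u.1 u.2 | u : 'I_n * 'I_n & (b <= u.1 <= c) && (s < u.2 < s.+3)].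
have gS (t z : 'I_n) : b <= t <= c -> s < z < s.+3 -> g t z \in S.
  by move=> h1 h2; apply/imsetP; exists (t, z) => //; rewrite inE h1.
have v2 := gB _ _ (erefl (L (upd y0 i a))).
have v4 := gB _ _ (erefl (L (upd y0 i b))).
have v1 := gB _ _ (erefl (L (upd y0 i c))).
have v3 := gB _ _ (erefl (L (upd y0 i e))).
have: S \subset B.
  apply: unbreakable_sub (mB) _ solL => _ /imsetP[[t z] /[!inE] /= /andP[tb zb] ->].
  have row (t1 t2 : 'I_n) :
      g t1 z \in B :|: S -> g t2 z \in B :|: S -> t1 < t < t2 ->
      between (B :|: S) (g t z).
    move=> h1 h2 lt; exists (lift ord_max i), (g t1 z), (g t2 z).
    by split=> //; rewrite !g_row.
  have col (z1 z2 : 'I_n) :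
      g t z1 \in B :|: S -> g t z2 \in B :|: S -> z1 < z < z2 ->
      between (B :|: S) (g t z).
    move=> h1 h2 lt; exists ord_max, (g t z1), (g t z2).
    by split=> //; rewrite !g_col.
  have bS (w : 'I_n) : s < w < s.+3 -> g b w \in B :|: S.
    by move=> h; rewrite inE gS ?orbT ?leqnn ?(ltnW bc).
  have cS (w : 'I_n) : s < w < s.+3 -> g c w \in B :|: S.
    by move=> h; rewrite inE gS ?orbT ?leqnn ?(ltnW bc).
  (* In column [b], height [s.+1] lies between the pattern cube of column [a] and column [c], and
     height [s.+2] lies below the pattern cube at [s.+3]. Column [c] is symmetric, using [e] and the
     height [s]. Inner columns lie between [b] and [c]. *)
  have [tb'|ntb] := eqVneq t b.
    subst t; have [zs|nzs] := eqVneq (val z) s.+1.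
      apply: (row a c); [|exact: cS|by rewrite ab bc].
      by rewrite inE (_ : z = L (upd y0 i a)) ?v2 //; apply: val_inj; rewrite /= pa.
    apply: (col (L (upd y0 i a)) (L (upd y0 i b)));
      last by rewrite pa pb; move/eqP: nzs => /=; lia.
      by apply: bS; rewrite pa; lia.
    by rewrite inE v4.
  have [tc|ntc] := eqVneq t c.
    subst t; have [zs|nzs] := eqVneq (val z) s.+2.
      apply: (row b e); [exact: bS| |by rewrite bc ce].
      by rewrite inE (_ : z = L (upd y0 i e)) ?v3 //; apply: val_inj; rewrite /= pe.
    apply: (col (L (upd y0 i c)) (L (upd y0 i e)));
      last by rewrite pc pe; move/eqP: nzs => /=; lia.
      by rewrite inE v1.
    by apply: cS; rewrite pe; lia.
  apply: (row b c); [exact: bS|exact: cS|].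
  by move: ntb ntc tb; rewrite -!(inj_eq val_inj) /=; lia.
have bac : b <= b <= c by rewrite leqnn ltnW.
have sac : s < L (upd y0 i a) < s.+3 by rewrite pa; lia.
(* The corner in column [b] at height [s.+1] would be in the graph, whose value there is [s.+3]. *)
move=> /subsetP/(_ _ (gS _ _ bac sac)).
rewrite mem_corresponding => /eqP/(congr1 val) /=; rewrite pa pb; lia.
Qed.

End Graph.

(** * Counting by relabelling blocks of four symbols *)

Section Counting.

(** Serves to bring the symbols of a block into a prescribed order while fixing all others. *)
Lemma perm_map_uniq (T : finType) (A : {set T}) (s t : seq T) :
  uniq s -> uniq t -> size s = size t -> {subset s <= A} -> {subset t <= A} ->
  exists2 u : {perm T}, u \in Sym A & map u s = t.
Proof.
elim: s t => [|a s IH] [|c t] //=.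
  by exists 1%g => //; rewrite inE perm_on1.
move=> /andP[a_s us] /andP[c_t ut] [st] sA tA.
have [||u uA ut'] := IH t us ut st.
- by move=> x xs; rewrite sA // inE xs orbT.
- by move=> x xt; rewrite tA // inE xt orbT.
have uA' : perm_on A u by rewrite inE in uA.
(* The swap corrects the image of [a] and moves nothing in the tail [t], which contains neither
   [u a] nor [c]. *)
exists (u * tperm (u a) c)%g.
  rewrite inE perm_onM //; apply/subsetP=> x; rewrite inE.
  case: tpermP => [-> _|-> _|_ _]; last by rewrite eqxx.
    by rewrite perm_closed // sA ?mem_head.
  by rewrite tA ?mem_head.
congr (_ :: _); first by rewrite permM tpermL.
rewrite -ut'; apply/eq_in_map => x xs; rewrite permM tpermD //.
  by rewrite (inj_eq perm_inj); apply: contraNneq a_s => ->.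
by apply: contraNneq c_t => ->; rewrite -ut' map_f.
Qed.

Variables (k n : nat) (y0 : cube k n) (i : 'I_k).
Implicit Types (L : array k n) (u : {perm 'I_n}).

Definition relabel u L : array k n := [ffun y => u (L y)].

Lemma relabel_inj u : injective (relabel u).
Proof.
by move=> L L' /ffunP e; apply/ffunP=> y; move: (e y); rewrite !ffunE => /perm_inj.
Qed.

Lemma line_map_relabel u L t :
  line_map (relabel u L) y0 i t = u (line_map L y0 i t).
Proof. by rewrite /line_map ffunE. Qed.

Lemma latin_relabel u L : latin L -> latin (relabel u L).
Proof.
move=> latL; apply/forallP=> j; apply/forallP=> x; apply/forallP=> s.
move: latL => /forallP/(_ j)/forallP/(_ x)/forallP/(_ (u^-1 s)%g).
congr (_ == _); apply: eq_card => y; rewrite !inE ffunE; congr (_ && _).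
by rewrite (canF_eq (permK u)).
Qed.

Lemma latin_line_map_surj L s : latin L -> exists t, line_map L y0 i t = s.
Proof.
move=> /forallP/(_ i)/forallP/(_ y0)/forallP/(_ s)/cards1P[y /setP/(_ y)].
rewrite !inE eqxx => /andP[yy' /eqP Ly]; exists (tnth y i).
rewrite -Ly; congr (L _); apply/eq_from_tnth => j; rewrite tnth_upd.
by case: eqVneq => [->//|ji]; have /same_offP-> := yy'.
Qed.

Lemma block_subproof m (j : 'I_4) : 4 * m.+1 <= n -> 4 * m + j < n.
Proof. by have := ltn_ord j; lia. Qed.

Definition block_elt m (mn : 4 * m.+1 <= n) j : 'I_n :=
  Ordinal (block_subproof j mn).

Definition block m (mn : 4 * m.+1 <= n) := block_elt mn @: 'I_4.

Lemma block_elt_inj m (mn : 4 * m.+1 <= n) : injective (block_elt mn).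
Proof. by move=> j l /(congr1 val) /= /addnI /val_inj. Qed.

Lemma card_block m (mn : 4 * m.+1 <= n) : #|block mn| = 4.
Proof. by rewrite card_imset ?card_ord //; apply: block_elt_inj. Qed.

Lemma relabel_pattern m (mn : 4 * m.+1 <= n) L : latin L ->
  exists2 u, u \in Sym (block mn) &
    pattern2413 (line_map (relabel u L) y0 i) (4 * m).
Proof.
move=> latL; pose p := line_map L y0 i.
have [q qP] := fin_all_exists (fun j => latin_line_map_surj (block_elt mn j) latL).
(* The positions of the block's symbols on the line, from left to right. *)
pose s := sort (relpre val leq) (codom q).
have q_inj : injective q.
  by move=> j l e; apply: (@block_elt_inj _ mn); rewrite -!qP e.
have us : uniq s by rewrite sort_uniq; apply/injectiveP.
have sz_s : size s = 4 by rewrite size_sort size_codom card_ord.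
have p_inj : {in s &, injective p}.
  move=> x y; rewrite !mem_sort => /codomP[j ->] /codomP[l ->].
  by rewrite /p !qP => /block_elt_inj ->.
have sub_s : {subset map p s <= block mn}.
  move=> _ /mapP[x + ->]; rewrite mem_sort => /codomP[j ->].
  by rewrite /p qP imset_f.
have sort_s : sorted (relpre val ltn) s.
  rewrite -sorted_map ltn_sorted_uniq_leq map_inj_uniq ?us; last exact: val_inj.
  by rewrite sorted_map; apply: sort_sorted => x y; apply: leq_total.
(* The pattern 2413 written with offsets from 0. *)
pose t := map (block_elt mn) [:: inord 1; inord 3; inord 0; inord 2].
have ut : uniq t.
  rewrite map_inj_uniq; last exact: block_elt_inj.
  by rewrite /= !inE -!(inj_eq val_inj) /= !inordK.
have sub_t : {subset t <= block mn} by move=> _ /mapP[j _ ->]; rewrite imset_f.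
have ups : uniq (map p s) by rewrite map_inj_in_uniq.
have [|u uB] := perm_map_uniq ups ut _ sub_s sub_t; first by rewrite size_map.
case: s sz_s sort_s {us p_inj sub_s ups} => [|a [|b [|c [|e []]]]] //= _.
case/and4P=> ab bc ce _ [pa pb pc pe].
exists u => //; apply/existsP; exists a; apply/existsP; exists b.
apply/existsP; exists c; apply/existsP; exists e.
by rewrite ab bc ce !line_map_relabel pa pb pc pe /= !inordK //; lia.
Qed.

(** Permuting block [m] fixes every symbol below [4 * m]. Contrapositively, the relabelling keeps
    earlier blocks free of the pattern. *)
Lemma pattern_relabel m (mn : 4 * m.+1 <= n) j u L :
  u \in Sym (block mn) -> j < m ->
  pattern2413 (line_map (relabel u L) y0 i) (4 * j) ->
  pattern2413 (line_map L y0 i) (4 * j).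
Proof.
move=> uB jm.
(* Outside the block [u] fixes [u x], so [u x = x] by injectivity. *)
have fix_u (x : 'I_n) l : u x = l :> nat -> l < 4 * m -> x = l :> nat.
  move=> uxl lm; suff ux : u x \notin block mn.
    rewrite -uxl; congr val; rewrite inE in uB.
    by apply: (perm_inj (s := u)); rewrite (out_perm uB ux).
  by apply/imsetP=> -[l' _ /(congr1 val)] /=; lia.
case/existsP=> a /existsP[b /existsP[c /existsP[e]]].
rewrite !line_map_relabel => /and5P[abce /eqP pa /eqP pb /eqP pc /eqP pe].
apply/existsP; exists a; apply/existsP; exists b.
apply/existsP; exists c; apply/existsP; exists e.
by rewrite abce (fix_u _ _ pa) ?(fix_u _ _ pb) ?(fix_u _ _ pc) ?(fix_u _ _ pe)
  ?eqxx //; lia.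
Qed.

Definition avoiders m := [set L : array k n |
  latin L && [forall j : 'I_m, ~~ pattern2413 (line_map L y0 i) (4 * j)]].

(** One of the 24 permutations of block [m] takes a given member of [avoiders m] into [Y], and each
    relabelling is injective. Hence [Y] has at least a 1/24 share of [avoiders m], and the rest is
    [avoiders m.+1]. *)
Lemma avoiders_decay m : 4 * m.+1 <= n ->
  24 * #|avoiders m.+1| <= 23 * #|avoiders m|.
Proof.
move=> mn; pose Y := avoiders m :\: avoiders m.+1.
have sub : avoiders m.+1 \subset avoiders m.
  apply/subsetP=> L; rewrite !inE => /andP[-> /forallP h]; apply/forallP=> j.
  exact: (h (widen_ord (leqnSn m) j)).
have cover : avoiders m \subset \bigcup_(u in Sym (block mn)) relabel u @^-1: Y.
  apply/subsetP=> L; rewrite inE => /andP[latL /forallP avL].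
  have [u uB patu] := relabel_pattern mn latL.
  apply/bigcupP; exists u => //; rewrite !inE latin_relabel //=.
  apply/andP; split; first by apply/forallPn; exists ord_max; rewrite negbK.
  by apply/forallP => j; apply: contra (avL j); exact: pattern_relabel uB _.
have: #|avoiders m| <= 24 * #|Y|.
  apply: leq_trans (subset_leq_card cover) _.
  apply: (@leq_trans (\sum_(u in Sym (block mn)) #|relabel u @^-1: Y|)).
    elim/big_ind2: _ => [|A1 a A2 b h1 h2|//]; first by rewrite cards0.
    by rewrite (leq_trans (leq_card_setU a b)) // leq_add.
  have <- : #|Sym (block mn)| = 24 by rewrite card_Sym card_block.
  rewrite -sum_nat_const; apply: leq_sum => u _.
  by rewrite card_preimset //; apply: relabel_inj.
rewrite /Y cardsD (setIidPr sub); have := subset_leq_card sub; lia.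
Qed.

Lemma card_avoiders m : 4 * m <= n ->
  24 ^ m * #|avoiders m| <= 23 ^ m * #|[set L : array k n | latin L]|.
Proof.
elim: m => [|m IH] mn.
  rewrite !mul1n; apply/subset_leq_card/subsetP=> L; rewrite !inE.
  by case/andP.
have mn' : 4 * m <= n by lia.
have := leq_mul (leqnn (24 ^ m)) (avoiders_decay mn).
have := leq_mul (leqnn 23) (IH mn').
rewrite !expnS !mulnA ![_ * 24]mulnC ![_ * 23]mulnC => h1 h2.
by rewrite (leq_trans h2) // -mulnA.
Qed.

End Counting.

(* The probability bound and its limit *)
From mathcomp Require Import all_classical all_reals all_analysis.
Import numFieldNormedType.Exports.
Import GRing.Theory Num.Theory.
Local Open Scope classical_set_scope.
Local Open Scope ring_scope.

Lemma prob_solution_le (R : realType) (d n : nat) : (2 <= d)%N -> (0 < n)%N ->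
  prob_solution R d n <= (23%:R / 24%:R) ^+ (n %/ 4).
Proof.
case: d => [|[|k]] // _ n_gt0.
(* A fixed line: through the all-zero cell, in direction [ord0], which exists since [d] is now
   [k.+2]. *)
pose y0 : cube k.+1 n := [tuple Ordinal n_gt0 | _ < k.+1].
rewrite /prob_solution /Defs.uniform_prob.
set A := finset _; set E := finset _; set m := (n %/ 4)%N.
have mn : (4 * m <= n)%N by rewrite mulnC leq_divM.
(* For empty [A] the quotient is 0, as the inverse of 0 is 0. *)
have [A0|A_gt0] := posnP #|A|; first by rewrite A0 invr0 mulr0 exprn_ge0 ?divr_ge0.
have AE : (#|A :&: E| <= #|avoiders y0 ord0 m|)%N.
  apply/subset_leq_card/fintype.subsetP => L; rewrite !inE => /andP[latL solL].
  by rewrite latL; apply/forallP => j; apply: solution_avoids solL.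
have := leq_trans (leq_mul (leqnn (24 ^ m)%N) AE) (card_avoiders y0 ord0 mn).
rewrite -/A expr_div_n ler_pdivrMr ?ltr0n // mulrAC ler_pdivlMr ?exprn_gt0 ?ltr0n //.
by rewrite -!natrX -!natrM ler_nat mulnC.
Qed.

Theorem theorem3 (R : realType) (d : nat) (hd : (2 <= d)%N) :
  prob_solution R d n @[n --> \oo] --> (0 : R).
Proof.
have cvg_div : (n %/ 4)%N @[n --> \oo] --> \oo.
  apply/cvgnyPge => N; exists (N * 4)%N => //= n; rewrite /= => Nn.
  by rewrite leq_divRL.
have r_lt1 : `|23%:R / 24%:R : R| < 1.
  by rewrite ger0_norm ?divr_ge0 // ltr_pdivrMr ?ltr0n // mul1r ltr_nat.
have cvg_r := cvg_comp _ _ cvg_div (cvg_expr r_lt1).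
apply: (squeeze_cvgr _ (cvg_cst 0) cvg_r).
(* The bound requires [0 < n], so the comparison starts at 1. *)
exists 1%N => //= n n_gt0; rewrite prob_solution_le // andbT.
by rewrite /prob_solution /Defs.uniform_prob divr_ge0.
Qed.
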